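(* Consider the $(\mathsf H,r,M,N)$ combination network with end-user-caches where $N\ge K=\binom{\mathsf H}{r}$. Take any sequence of schemes with uncoded cache placement, with file sizes $B\to\infty$, achieving the optimal max-link load under uncoded placement $R^\star_{\mathrm u}=R^\star_{\mathrm u}(M)$, and let $(x_{\mathcal W})_{\mathcal W\subseteq[K]}$ be any limit point, as $B\to\infty$, of the normalized subfile sizes $$x_{\mathcal W}=\frac{1}{NB}\sum_{i\in[N]}|F_{i,\mathcal W}|,\qquad \mathcal W\subseteq[K].$$ Then $$\sum_{\mathcal W\subseteq[K]}x_{\mathcal W}=1,\qquad \sum_{\mathcal W\subseteq[K]:\,i\in\mathcal W}x_{\mathcal W}\le\frac MN\quad\forall i\in[K],$$ and there exist real numbers $y_{\mathcal Q}\ge0$, for $\mathcal Q\subseteq[\mathsf H]$ with $|\mathcal Q|\ge r$, such that the following hold. (a) For each integer $b\in\{r,\dots,\mathsf H\}$, each $\mathcal Q\subseteq[\mathsf H]$ with $|\mathcal Q|=b$, each integer $a\in[\lfloor b/r\rfloor]$, each disjoint partition $\mathcal Q=\mathcal Q_1\cup\dots\cup\mathcal Q_a$ with $|\mathcal Q_i|\ge r$ for all $i\in[a]$, and each choice of permutations $\mathbf p(\mathcal K_{\mathcal Q_1}),\dots,\mathbf p(\mathcal K_{\mathcal Q_a}),\mathbf p(\mathcal K_{\mathcal Q}\setminus\mathcal V)$, where $\mathcal V=\bigcup_{i\in[a]}\mathcal K_{\mathcal Q_i}$, $$|\mathcal Q|\,R^\star_{\mathrm u}\ \ge\ \sum_{i\in[a]}\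 \sum_{j\in[|\mathcal K_{\mathcal Q_i}|]}\ \sum_{\mathcal W\subseteq[K]\setminus\{p_1(\mathcal K_{\mathcal Q_i}),\dots,p_j(\mathcal K_{\mathcal Q_i})\}}x_{\mathcal W}\ +\sum_{j\in[|\mathcal K_{\mathcal Q}\setminus\mathcal V|]}\ \sum_{\mathcal W\subseteq([K]\setminus\mathcal V)\setminus\{p_1(\mathcal K_{\mathcal Q}\setminus\mathcal V),\dots,p_j(\mathcal K_{\mathcal Q}\setminus\mathcal V)\}}x_{\mathcal W}\ +\ y_{\mathcal Q}.$$ (b) For each integer $b\in\{r,\dots,\mathsf H\}$ and each permutation $\mathbf p([K])$ of $[K]$, $$\sum_{\mathcal Q\subseteq[\mathsf H]:|\mathcal Q|=b}y_{\mathcal Q}\ \ge\ \sum_{i\in[K]}\ \sum_{\mathcal W\subseteq[K]\setminus\{p_1([K]),\dots,p_i([K])\}}c\bigl(\{p_i([K])\}\cup\mathcal W,\,b\bigr)\,x_{\mathcal W},$$ where $$c(\mathcal W_1,l)=\max\left\{\binom{\mathsf H-1}{l-1}-\bigl|\{\mathcal Q\subseteq[\mathsf H]:|\mathcal Q|=l,\ \mathcal K_{\mathcal Q}\nsubseteq[K]\setminus\mathcal W_1\}\bigr|,\ 0\right\}.$$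
   Context: Notation: $[n]=\{1,\dots,n\}$. For a finite set $\mathcal J$, $\mathbf p(\mathcal J)=(p_1(\mathcal J),\dots,p_{|\mathcal J|}(\mathcal J))$ denotes a permutation (ordering) of its elements. Network. An $(\mathsf H,r,M,N)$ combination network with end-user-caches ($1\le r\le\mathsf H$, $0\le M\le N$) has one server with $N$ files $F_1,\dots,F_N$, each consisting of $B$ independent uniform bits (files mutually independent), $\mathsf H$ relays without caches, and $K=\binom{\mathsf H}{r}$ users, each connected to a distinct $r$-subset of the relays. The server is connected to every relay. All links are error-free and interference-free. $\mathcal U_h\subseteq[K]$ is the set of users connected to relay $h$, $\mathcal H_k\subseteq[\mathsf H]$ the set of relays connected to user $k$, and $\mathcal K_{\mathcal J}=\{k\in[K]:\mathcal H_k\subseteq\mathcal J\}$ the set of users whose connected relays all lie in $\mathcal J\subseteq[\mathsf H]$. Scheme. In the placement phase user $k$ stores a content $Z_k$ of at most $MB$ bits (a function of the files) without knowing the demands. The placement is uncoded if each $Z_k$ consists of bits copied directly from the files; then $F_{i,\mathcal W}$ denotes the set of bits of $F_i$ stored by exactly the users in $\mathcal W\subseteq[K]$, and $|F_{i,\mathcal W}|$ its number of bits. In the delivery phase user $k$ demands $F_{d_k}$, $d_k\in[N]$; the demand vector $\mathbf d=(d_1,\dots,d_K)$ is known to all nodes. The server sends to relay $h$ a message $X_h$ of $B R_h(\mathbf d)$ bits, and relay $h$ sends to each user $k\in\mathcal U_h$ a message $X_{h\to k}$ (a function of $X_h$) of $B R_{h\to k}(\mathbf d)$ bits. User $k$ must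 recover $F_{d_k}$ from $Z_k$ and $(X_{h\to k}:h\in\mathcal H_k)$ with high probability. The max-link load of a scheme is $\max_{h,\,k\in\mathcal U_h,\,\mathbf d\in[N]^K}\max\{R_h(\mathbf d),R_{h\to k}(\mathbf d)\}$. A load $R$ is achieved for memory $M$ by a sequence of schemes with file sizes $B\to\infty$ if the error probability tends to $0$ and the max-link load has limsup at most $R$. $R^\star_{\mathrm u}(M)$ is the minimum load achievable with uncoded placement. *)

(* Defs.v *)
From HB Require Import structures.
From mathcomp Require Import all_boot all_order all_algebra all_fingroup.
From mathcomp Require Import all_classical all_reals all_analysis.

Set Implicit Arguments.
Unset Strict Implicit.
Unset Printing Implicit Defensive.

Import Order.TTheory GRing.Theory Num.Theory.
Import numFieldNormedType.Exports.

Local Open Scope classical_set_scope.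
Local Open Scope ring_scope.

(* All index sets {1, ..., n} are rendered as 'I_n, hence are 0-based. *)

(* The K = 'C(H, r) users are connected to pairwise distinct r-subsets of the
   relays; by counting, every r-subset is the neighbourhood of one user. *)
Record network (H r : nat) := Network {
  relays : 'I_'C(H, r) -> {set 'I_H};
  relays_inj : injective relays;
  card_relays : forall k, #|relays k| = r }.

Section Network.
Variables (H r : nat) (net : network H r).
Local Notation K := 'C(H, r).

Definition users (h : 'I_H) : {set 'I_K} := [set k | h \in relays net k]%SET.

Definition users_within (J : {set 'I_H}) : {set 'I_K} :=
  [set k | relays net k \subset J]%SET.

(* The maximum with 0 is the truncated subtraction of nat. *)
Definition coef (W1 : {set 'I_K}) (l : nat) : nat :=
  ('C(H.-1, l.-1) -
   #|[set Q : {set 'I_H} |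
       (#|Q| == l) && ~~ (users_within Q \subset (~: W1)%SET)]%SET|)%N.

End Network.

(* An ordering p_1, ..., p_n of a finite set J of cardinality n. *)
Definition is_ordering (T : finType) (J : {set T}) (p : 'I_#|J| -> T) : Prop :=
  injective p /\ [set p j | j : 'I_#|J|]%SET = J.

(* {p_1, ..., p_j}, the index j itself being included. *)
Definition first_upto (T : finType) (n : nat) (p : 'I_n -> T) (j : 'I_n) :
  {set T} := [set p l | l : 'I_n & (l <= j)%N]%SET.

Definition files (N B : nat) := {ffun 'I_N -> B.-tuple bool}.

(* Bit positions (file, bit) outside of S are erased. *)
Definition read_bits (N B : nat) (S : {set 'I_N * 'I_B}) (F : files N B) :
  {ffun 'I_N * 'I_B -> option bool} :=
  [ffun x => if x \in S then Some (tnth (F x.1) x.2) else None].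

(* A coding scheme with uncoded placement, for files of B bits.  An uncoded
   cache is given by the set of bit positions that are copied into it; it is
   chosen before the demands d.  The numbers of transmitted bits depend on the
   demands only, not on the realization of the files. *)
Record scheme (R : realType) (H r : nat) (net : network H r) (N : nat) (M : R)
    (B : nat) := Scheme {
  stored : 'I_'C(H, r) -> {set 'I_N * 'I_B};
  card_stored : forall k, #|stored k|%:R <= M * B%:R;
  server_len : {ffun 'I_'C(H, r) -> 'I_N} -> 'I_H -> nat;
  server_msg : forall (d : {ffun 'I_'C(H, r) -> 'I_N}) (h : 'I_H),
    files N B -> (server_len d h).-tuple bool;
  relay_len : {ffun 'I_'C(H, r) -> 'I_N} -> 'I_H -> 'I_'C(H, r) -> nat;
  relay_msg : forall (d : {ffun 'I_'C(H, r) -> 'I_N}) (h : 'I_H)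
      (k : 'I_'C(H, r)),
    (server_len d h).-tuple bool -> (relay_len d h k).-tuple bool;
  decoder : {ffun 'I_'C(H, r) -> 'I_N} -> 'I_'C(H, r) ->
    {ffun 'I_N * 'I_B -> option bool} -> ('I_H -> seq bool) -> B.-tuple bool }.

Arguments server_msg {R H r net N M B} s d h F : rename.
Arguments relay_msg {R H r net N M B} s d h k X : rename.

Section Scheme.
Variables (R : realType) (H r : nat) (net : network H r) (N : nat) (M : R).
Local Notation K := 'C(H, r).

Section FixedFileSize.
Variables (B : nat) (s : scheme net N M B).

(* User k gets nothing from the relays it is not connected to. *)
Definition received (d : {ffun 'I_K -> 'I_N}) (k : 'I_K) (F : files N B)
    (h : 'I_H) : seq bool :=
  if h \in relays net k then
    tval (relay_msg s d h k (server_msg s d h F))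
  else [::].

Definition decoded (d : {ffun 'I_K -> 'I_N}) (k : 'I_K) (F : files N B) :
  B.-tuple bool := decoder s d k (read_bits (stored s k) F) (received d k F).

(* Worst case over the demands of the probability, under uniform files, that
   some user does not recover its demanded file. *)
Definition error_prob : R :=
  \big[Num.max/0]_(d : {ffun 'I_K -> 'I_N})
    (#|[set F : files N B | [exists k, decoded d k F != F (d k)]]%SET|%:R
       / #|{: files N B}|%:R).

Definition max_link_load : R :=
  \big[Num.max/0]_(d : {ffun 'I_K -> 'I_N})
    \big[Num.max/0]_(h < H) \big[Num.max/0]_(k in users net h)
      Num.max ((server_len s d h)%:R / B%:R) ((relay_len s d h k)%:R / B%:R).

Definition subfile (i : 'I_N) (W : {set 'I_K}) : {set 'I_B} :=
  [set b | [set k | (i, b) \in stored s k]%SET == W]%SET.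

Definition subfile_size (W : {set 'I_K}) : R :=
  (N * B)%:R^-1 * \sum_(i < N) #|subfile i W|%:R.

End FixedFileSize.

Definition achieves (B : nat -> nat) (s : forall n, scheme net N M (B n))
    (L : R) : Prop :=
  [/\ B n @[n --> \oo] --> \oo,
      error_prob (s n) @[n --> \oo] --> 0
    & (limn_esup (fun n => (max_link_load (s n))%:E) <= L%:E)%E].

Definition achievable (L : R) : Prop :=
  exists (B : nat -> nat) (s : forall n, scheme net N M (B n)), achieves s L.

End Scheme.

(* R*_u is the load L such that is_optimal_load net N M L. *)
Definition is_optimal_load (R : realType) (H r : nat) (net : network H r)
    (N : nat) (M L : R) : Prop :=
  achievable net N M L /\ (forall L', achievable net N M L' -> L <= L').

Definition subseq_limit (R : realType) (T : finType) (u : nat -> T -> R)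
    (x : T -> R) : Prop :=
  exists phi : nat -> nat, {homo phi : m n / (m < n)%N} /\
    forall t, u (phi n) t @[n --> \oo] --> x t.

(* Main.v *)
Require Import Defs.
From mathcomp Require Import all_boot all_order all_algebra all_fingroup.
From mathcomp Require Import all_classical all_reals all_analysis.
From mathcomp Require Import ring lra zify.

(* Let J equal a constant when every user decodes and equal the whole library
   otherwise.  Appending J to every message makes decoding error-free and costs
   o(B) bits of entropy, so one may assume zero error.  For a set Q of relays
   and a set S of bits let g(Q, S) = H(X_Q | S), and let S_U be the set of bits
   cached or demanded by the users in U.

   If user k sees only relays in Q, decoding F_{d_k} gives
   g(Q, S_U) >= |F_{d_k} minus the caches of U and k| + g(Q, S_{U+k}).
   Iterating over the orderings of the K_{Q_i}, using the subadditivity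
   sum_i g(Q_i, S_V) >= g(Q, S_V), and iterating over K_Q minus V yields (a)
   with y_Q = g(Q, S_{K_Q}) / B, averaged over cyclically shifted demands.

   For (b), let T be the set of bits occurring on the right-hand side with a
   positive coefficient.  Conditioning moreover on the complement of T loses at
   most |S_{K_Q} cap T| bits for each Q, Han's inequality bounds
   sum_Q g(Q, ~T) below by binom(H-1, b-1) g([H], ~T), and g([H], ~T) = |T|
   because the users, taken in the order p, decode all of T.

   Finally y_Q is the limit superior of these averages along the subsequence. *)

Set Implicit Arguments.
Unset Strict Implicit.
Unset Printing Implicit Defensive.

Import Order.TTheory GRing.Theory Num.Theory.
Import numFieldNormedType.Exports.

Local Open Scope ring_scope.

(** * Entropy of functions of a uniform variable *)

Section Entropy.
Variables (R : realType) (Om : finType) (w0 : Om).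

Lemma ln_le_subr1 (x : R) : 0 < x -> ln x <= x - 1.
Proof.
move=> x0; have /le_ln1Dx : -1 < x - 1 by lra.
by rewrite (_ : 1 + (x - 1) = x) //; ring.
Qed.

Lemma ln2_gt0 : 0 < ln 2 :> R. Proof. by apply: ln_gt0; lra. Qed.

Definition fiber (T : eqType) (f : Om -> T) (w : Om) : {set Om} :=
  [set v | f v == f w].

(** Shannon entropy, in bits, of [f] at a uniform point of [Om]: the value [f w] has probability
    [#|fiber f w| / #|Om|]. Only the partition into fibers enters, so [T] need not be finite. *)
Definition entropy (T : eqType) (f : Om -> T) : R :=
  (ln #|Om|%:R - #|Om|%:R^-1 * \sum_w ln #|fiber f w|%:R) / ln 2.

Lemma fiber_gt0 (T : eqType) (f : Om -> T) w : 0 < #|fiber f w|%:R :> R.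
Proof. by rewrite ltr0n; apply/card_gt0P; exists w; rewrite inE. Qed.

Lemma card_Om_gt0 : 0 < #|Om|%:R :> R.
Proof. by rewrite ltr0n; apply/card_gt0P; exists w0. Qed.

Lemma mem_fiber (T : eqType) (f : Om -> T) v w :
  (v \in fiber f w) = (f v == f w).
Proof. by rewrite inE. Qed.

Lemma le_entropy (T T' : eqType) (f : Om -> T) (g : Om -> T') :
  (forall v w, f v = f w -> g v = g w) -> entropy g <= entropy f.
Proof.
move=> fg; rewrite ler_pM2r ?invr_gt0 ?ln2_gt0// lerD2l lerN2.
rewrite ler_pM2l ?invr_gt0 ?card_Om_gt0//; apply: ler_sum => w _.
rewrite ler_ln ?posrE ?fiber_gt0// ler_nat.
apply/subset_leq_card/fintype.subsetP => v.
by rewrite !mem_fiber => /eqP /fg /eqP.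
Qed.

Lemma entropy_eq (T T' : eqType) (f : Om -> T) (g : Om -> T') :
  (forall v w, (f v == f w) = (g v == g w)) -> entropy f = entropy g.
Proof.
by move=> fg; apply/eqP; rewrite eq_le; apply/andP; split;
  apply: le_entropy => v w /eqP; [rewrite -fg|rewrite fg] => /eqP.
Qed.

Lemma sum_fiber_inv (T : eqType) (f : Om -> T) w :
  \sum_(v in fiber f w) #|fiber f v|%:R^-1 = 1 :> R.
Proof.
rewrite (eq_bigr (fun=> #|fiber f w|%:R^-1)) => [|v]; last first.
  rewrite mem_fiber => /eqP fvw; congr (_%:R^-1); apply: eq_card => u.
  by rewrite !mem_fiber fvw.
by rewrite sumr_const -[LHS]mulr_natr mulVf// gt_eqF// fiber_gt0.
Qed.

(* Counting pairs (a, b) with f1 a = f1 w and f2 b = f2 w makes the sum over w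
   collapse to one fiber of f12. *)
Lemma sum_fiber_ratio (T1 T2 T12 T0 : eqType) (f1 : Om -> T1) (f2 : Om -> T2)
    (f12 : Om -> T12) (f0 : Om -> T0) :
  (forall v w, (f12 v == f12 w) = (f1 v == f1 w) && (f2 v == f2 w)) ->
  (forall v w, f1 v = f1 w -> f0 v = f0 w) ->
  (forall v w, f2 v = f2 w -> f0 v = f0 w) ->
  \sum_w (#|fiber f1 w|%:R * #|fiber f2 w|%:R
          / (#|fiber f12 w|%:R * #|fiber f0 w|%:R)) <= #|Om|%:R :> R.
Proof.
move=> f12E f10 f20.
pose c (w a b : Om) : R := ((f1 a == f1 w) && (f2 b == f2 w))%:R.
have cE w : #|fiber f1 w|%:R * #|fiber f2 w|%:R = \sum_a \sum_b c w a b.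
  rewrite -!sum1_card !natr_sum big_mkcond [X in _ * X]big_mkcond mulr_suml.
  apply: eq_bigr => a _; rewrite mulr_sumr; apply: eq_bigr => b _.
  by rewrite /c !mem_fiber; do 2 case: eqP => _; rewrite ?mulr0 ?mul0r ?mulr1.
rewrite (eq_bigr (fun w => \sum_a \sum_b
   c w a b / (#|fiber f12 w|%:R * #|fiber f0 w|%:R))); last first.
  by move=> w _; rewrite cE mulr_suml; apply: eq_bigr => a _; rewrite mulr_suml.
rewrite exchange_big /=.
under eq_bigr do rewrite exchange_big /=.
(* For fixed [a] and [b] the contributing [w] are either none or exactly one fiber of [f12]. On it
   the inverse sizes of the [f12]-fibers sum to 1, and the [f0]-fiber is that of [a]. *)
have H a b : \sum_w c w a b / (#|fiber f12 w|%:R * #|fiber f0 w|%:R)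
    <= (f0 b == f0 a)%:R / #|fiber f0 a|%:R.
  have [[w /andP[/eqP fa /eqP fb]]|nex] :=
      pselect (exists w, (f1 a == f1 w) && (f2 b == f2 w)); last first.
    rewrite big1 => [|w _]; first by rewrite divr_ge0.
    rewrite /c.
    suff /negPf-> : ~~ ((f1 a == f1 w) && (f2 b == f2 w)) by rewrite mul0r.
    by apply/negP => ?; apply: nex; exists w.
  have f0a := f10 _ _ fa; have f0b := f20 _ _ fb.
  rewrite f0b f0a eqxx mul1r.
  rewrite (bigID (mem (fiber f12 w)))/= [X in _ + X]big1 ?addr0; last first.
    move=> v; rewrite mem_fiber f12E => H; rewrite /c fa fb eq_sym.
    rewrite [X in _ && X]eq_sym.
    by rewrite (negPf H) mul0r.
  have -> : #|fiber f0 a|%:R^-1 =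
      \sum_(v in fiber f12 w) #|fiber f12 v|%:R^-1 * #|fiber f0 a|%:R^-1 :> R.
    by rewrite -mulr_suml sum_fiber_inv mul1r.
  apply: ler_sum => v; rewrite mem_fiber f12E => /andP[/eqP v1 /eqP v2].
  have -> : fiber f0 v = fiber f0 a.
    by apply/setP => u; rewrite !mem_fiber f0a (f10 _ _ v1).
  by rewrite /c fa fb v1 v2 !eqxx mul1r invfM.
apply: (@le_trans _ _ (\sum_(a : Om) 1)); last first.
  by rewrite sumr_const cardT.
apply: ler_sum => a _.
apply: le_trans (ler_sum _ (fun b _ => H a b)) _.
rewrite -mulr_suml -natr_sum.
have -> : (\sum_b (f0 b == f0 a) = #|fiber f0 a|)%N.
  rewrite -sum1_card [RHS]big_mkcond; apply: eq_bigr => b _.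
  by rewrite mem_fiber; case: eqP.
by rewrite mulfV// gt_eqF ?fiber_gt0.
Qed.

(** Nonnegativity of the mutual information of [f1] and [f2] given [f0]: apply [ln t <= t - 1] to
    the ratio of fiber sizes, whose average over [Om] is at most 1 by [sum_fiber_ratio]. *)
Lemma entropy_submod (T1 T2 T12 T0 : eqType) (f1 : Om -> T1) (f2 : Om -> T2)
    (f12 : Om -> T12) (f0 : Om -> T0) :
  (forall v w, (f12 v == f12 w) = (f1 v == f1 w) && (f2 v == f2 w)) ->
  (forall v w, f1 v = f1 w -> f0 v = f0 w) ->
  (forall v w, f2 v = f2 w -> f0 v = f0 w) ->
  entropy f12 + entropy f0 <= entropy f1 + entropy f2.
Proof.
move=> f12E f10 f20.
rewrite -!mulrDl ler_pM2r ?invr_gt0 ?ln2_gt0//.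
pose s (T : eqType) (f : Om -> T) : R := \sum_w ln #|fiber f w|%:R.
suff : s _ f1 + s _ f2 - s _ f12 - s _ f0 <= 0.
  rewrite -/(s _ f1) -/(s _ f2) -/(s _ f12) -/(s _ f0) => H.
  have : #|Om|%:R^-1 * (s _ f1 + s _ f2 - s _ f12 - s _ f0) <= 0.
    by rewrite pmulr_rle0 ?invr_gt0 ?card_Om_gt0.
  by rewrite !mulrDr !mulrN; lra.
rewrite /s -big_split -!sumrB /=.
apply: (@le_trans _ _ (\sum_w (#|fiber f1 w|%:R * #|fiber f2 w|%:R
          / (#|fiber f12 w|%:R * #|fiber f0 w|%:R) - 1))); last first.
  rewrite sumrB sumr_const subr_le0.
  exact: le_trans (sum_fiber_ratio f12E f10 f20) _.
apply: ler_sum => w _; apply: le_trans (ln_le_subr1 _).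
  by rewrite ln_div ?lnM ?posrE ?mulr_gt0 ?fiber_gt0//; lra.
by rewrite divr_gt0 ?mulr_gt0 ?fiber_gt0.
Qed.

Lemma entropy_cst (T : eqType) (c : T) : entropy (fun=> c) = 0.
Proof.
rewrite /entropy (eq_bigr (fun=> ln #|Om|%:R)) => [|w _]; last first.
  by congr (ln _%:R); apply: eq_card => v; rewrite !inE eqxx.
rewrite sumr_const -(mulr_natl (ln _)) mulrA mulVf ?gt_eqF ?card_Om_gt0//.
by rewrite mul1r subrr mul0r.
Qed.

Lemma entropy_ge0 (T : eqType) (f : Om -> T) : 0 <= entropy f.
Proof. by rewrite -(entropy_cst tt); apply: le_entropy. Qed.

Lemma entropy_pair (T1 T2 : eqType) (f1 : Om -> T1) (f2 : Om -> T2) :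
  entropy (fun w => (f1 w, f2 w)) <= entropy f1 + entropy f2.
Proof.
rewrite -[leLHS]addr0 -(entropy_cst tt); apply: entropy_submod => //.
Qed.

Lemma entropy_inj (T : eqType) (f : Om -> T) : injective f ->
  entropy f = ln #|Om|%:R / ln 2.
Proof.
move=> fI; rewrite /entropy big1 ?mulr0 ?subr0// => w _.
have -> : fiber f w = [set w].
  by apply/setP => v; rewrite mem_fiber inE (inj_eq fI).
by rewrite cards1 ln1.
Qed.

(** Apply [ln t <= t - 1] with [t] the quotient of [#|Om|] by [#|T| * #|fiber f w|]; the inverse
    fiber sizes summed over [w] count the values attained by [f], at most [#|T|]. *)
Lemma entropy_le_card (T : finType) (f : Om -> T) :
  entropy f <= ln #|T|%:R / ln 2.
Proof.
rewrite ler_pM2r ?invr_gt0 ?ln2_gt0// lerBlDr.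
have T0 : 0 < #|T|%:R :> R by rewrite ltr0n; apply/card_gt0P; exists (f w0).
have : \sum_w (ln #|Om|%:R - ln #|T|%:R - ln #|fiber f w|%:R) <= 0 :> R.
  apply: (@le_trans _ _ (\sum_w (#|Om|%:R / (#|T|%:R * #|fiber f w|%:R) - 1))).
    apply: ler_sum => w _; apply: le_trans (ln_le_subr1 _).
      by rewrite ln_div ?lnM ?posrE ?mulr_gt0 ?fiber_gt0 ?card_Om_gt0//; lra.
    by rewrite divr_gt0 ?mulr_gt0 ?fiber_gt0 ?card_Om_gt0.
  rewrite sumrB sumr_const subr_le0.
  under eq_bigr do rewrite invfM.
  rewrite -!mulr_sumr -[leRHS]mulr1 ler_pM2l ?card_Om_gt0//.
  rewrite ler_pdivrMl// mulr1 (partition_big f predT)//=.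
  apply: (@le_trans _ _ (\sum_(t : T) 1)); last by rewrite sumr_const.
  apply: ler_sum => t _.
  have [/existsP[w /eqP <-]|] := boolP [exists w, f w == t].
    by under eq_bigl do rewrite -mem_fiber; rewrite sum_fiber_inv.
  by rewrite negb_exists => /forallP H; rewrite big_pred0// => w; apply: negPf.
rewrite sumrB sumr_const -(mulr_natl (_ - _)) subr_le0 => H.
by rewrite -lerBlDl ler_pdivlMl ?card_Om_gt0.
Qed.

(** With [n] points in all and [a] of them in [A], the entropy times [ln 2] is
    [(n - a) / n * ln n + a / n * ln (n / a)], the last term being 0 if [a = 0]. That term is at
    most [(n - a) / n], again by [ln t <= t - 1]. *)
Lemma entropy_repair (A : {set Om}) :
  entropy (fun w => if w \in A then None else Some w) <=
  (#|~: A|%:R / #|Om|%:R) * (ln #|Om|%:R + 1) / ln 2.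
Proof.
rewrite ler_pM2r ?invr_gt0 ?ln2_gt0//.
set f : Om -> option Om := fun w => if w \in A then None else Some w.
have fA w : #|fiber f w|%:R = (if w \in A then #|A|%:R else 1) :> R.
  have -> : fiber f w = if w \in A then A else [set w].
    apply/setP => v; rewrite mem_fiber /f.
    case: (boolP (w \in A)) => wA.
      by case: (v \in A).
    case: (boolP (v \in A)) => vA; rewrite inE //.
    by apply/esym/negP => /eqP vw; rewrite -vw vA in wA.
  by case: ifP; rewrite ?cards1.
rewrite (eq_bigr (fun w => if w \in A then ln #|A|%:R else 0)); last first.
  by move=> w _; rewrite fA; case: ifP => // _; rewrite ln1.
rewrite -big_mkcond/= sumr_const -(mulr_natl (ln _)).
have n0 := card_Om_gt0.
have cE : #|~: A|%:R = #|Om|%:R - #|A|%:R :> R.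
  by rewrite -(cardsC A) natrD addrC addKr.
rewrite cE; set n := #|Om|%:R in n0 *; set a := #|A|%:R.
rewrite -(ler_pM2l n0).
have -> : n * (ln n - n^-1 * (a * ln a)) = n * ln n - a * ln a by field; lra.
have -> : n * ((n - a) / n * (ln n + 1)) = (n - a) * (ln n + 1) by field; lra.
suff : a * (ln n - ln a) <= n - a by lra.
have [a0|] := ltrP 0 a; last first.
  rewrite le_eqVlt => /orP[/eqP->|]; last by rewrite ltNge ler0n.
  by rewrite mul0r subr0 ltW.
rewrite -ln_div ?posrE//.
apply: le_trans (_ : a * (n / a - 1) <= _).
  by rewrite ler_pM2l// ln_le_subr1// divr_gt0.
have -> : a * (n / a - 1) = n - a by field; lra.
by [].
Qed.

End Entropy.

(** * Han's inequality *)

Section Han.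
Variables (R : realType) (H : nat) (v : {set 'I_H} -> R).
Hypothesis v0 : v finset.set0 = 0.
Hypothesis v_submod : forall A B, v (A :|: B) + v (A :&: B) <= v A + v B.

Let pre (m : nat) : {set 'I_H} := [set h : 'I_H | (h < m)%N].
Let marg (h : nat) : R := v (pre h.+1) - v (pre h).

(** Diminishing returns: by submodularity, adding [h] to the part of [Q] below [h] gains at least
    [marg h], the gain from adding it to all relays below [h]. *)
Let sum_marg_le (Q : {set 'I_H}) : \sum_(h in Q) marg h <= v Q.
Proof.
have IH m : (m <= H)%N -> \sum_(h in Q | (h < m)%N) marg h <= v (Q :&: pre m).
  elim: m => [_|m IH mH].
    rewrite big_pred0 => [|h]; last by rewrite andbF.
    by rewrite (_ : _ :&: _ = finset.set0) ?v0//; apply/setP => h;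
      rewrite !inE andbF.
  have {IH} := IH (ltnW mH); pose h := Ordinal mH => IH.
  have lem (i : 'I_H) : (i < m.+1)%N = (i == h) || (i < m)%N.
    by rewrite ltnS leq_eqVlt.
  case: (boolP (h \in Q)) => hQ; last first.
    rewrite (_ : Q :&: pre m.+1 = Q :&: pre m); last first.
      apply/setP => i; rewrite !inE lem.
      by case: (eqVneq i h) => [->|//]; rewrite (negPf hQ).
    apply: le_trans IH; rewrite le_eqVlt; apply/orP/or_introl/eqP/eq_bigl => i.
    rewrite lem.
    by case: (eqVneq i h) => [->|//]; rewrite (negPf hQ).
  rewrite (bigD1 h) /=; last by rewrite hQ leqnn.
  rewrite (eq_bigl (fun i => (i \in Q) && (i < m)%N)) => [|i]; last first.
    rewrite lem; case: (eqVneq i h) => [->|_]; last by rewrite andbT.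
    by rewrite /= ltnn !andbF.
  have := v_submod (Q :&: pre m.+1) (pre m).
  have -> : (Q :&: pre m.+1) :|: pre m = pre m.+1.
    apply/setP => i; rewrite !inE lem.
    by case: (eqVneq i h) => [->|_]; rewrite ?hQ//= orb_idl // => /andP[].
  have -> : (Q :&: pre m.+1) :&: pre m = Q :&: pre m.
    apply/setP => i; rewrite !inE -andbA; congr (_ && _).
    by rewrite andb_idl// => /leqW.
  by rewrite /marg; lra.
have := IH H (leqnn H).
rewrite (eq_bigl (mem Q)) => [|h]; last by rewrite ltn_ord andbT.
by rewrite (_ : Q :&: _ = Q)//; apply/setP => h; rewrite !inE ltn_ord andbT.
Qed.

Lemma card_draws_containing (T : finType) (h : T) b : (0 < b)%N ->
  #|[set Q : {set T} | (#|Q| == b) && (h \in Q)]| = 'C(#|T|.-1, b.-1).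
Proof.
case: b => // b _ /=.
have := card_draws T b.+1.
rewrite -(cardsID [set Q : {set T} | h \in Q]).
have -> : [set A : {set T} | #|A| == b.+1] :&: [set Q : {set T} | h \in Q] =
  [set Q : {set T} | (#|Q| == b.+1) && (h \in Q)]
  by apply/setP=> Q; rewrite !inE.
have -> : [set A : {set T} | #|A| == b.+1] :\: [set Q : {set T} | h \in Q] =
  [set Q : {set T} | (Q \subset [set~ h]) & (#|Q| == b.+1)].
  apply/setP=> Q; rewrite !inE -finset.disjoints_subset disjoint_sym disjoints1.
  by rewrite andbC.
rewrite cards_draws cardsC1.
have : (0 < #|T|)%N by apply/card_gt0P; exists h.
by case: #|T| => // n _ /=; rewrite binS; lia.
Qed.

(** Each [h] lies in ['C(H.-1, b.-1)] of the sets [Q], and the increments [marg h] telescope to the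
    value on all relays. *)
Lemma han_ineq b : (0 < b)%N ->
  'C(H.-1, b.-1)%:R * v [set: 'I_H] <= \sum_(Q : {set 'I_H} | #|Q| == b) v Q.
Proof.
move=> b0; apply: le_trans (ler_sum _ (fun Q _ => sum_marg_le Q)).
rewrite (exchange_big_dep predT)//=.
rewrite (eq_bigr (fun h : 'I_H => 'C(H.-1, b.-1)%:R * marg h)) => [|h _].
  rewrite -mulr_sumr -(big_mkord predT marg) /marg telescope_sumr//.
  have -> : pre H = [set: 'I_H] by apply/setP => h; rewrite !inE ltn_ord.
  have -> : pre 0 = finset.set0 by apply/setP => h; rewrite !inE.
  by rewrite v0 subr0.
rewrite sumr_const -(mulr_natl (marg h)); congr (_%:R * _).
by rewrite -[X in 'C(X.-1, _)]card_ord -(card_draws_containing h b0) cardsE.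
Qed.

End Han.

(** * Converse bounds for one demand vector *)

Section Converse.
Variables (R : realType) (H r : nat) (net : network H r) (N B : nat).
Local Notation K := 'C(H, r).
Local Notation bits := ('I_N * 'I_B)%type.
Variables (Z : 'I_K -> {set bits}) (d : 'I_K -> 'I_N).
(** [f Q S] models the joint entropy of the messages to the relays in [Q] and the bits in [S]. The
    converse uses only the properties of [f] assumed below, which hold for schemes with repaired
    messages. *)
Variables (f : {set 'I_H} -> {set bits} -> R) (load : R).
Hypothesis d_inj : injective d.
Hypothesis f_bits : forall S, f finset.set0 S = #|S|%:R.
Hypothesis f_mono : forall (Q Q' : {set 'I_H}) (S S' : {set bits}),
  Q \subset Q' -> S \subset S' -> f Q S <= f Q' S'.
Hypothesis f_submod : forall Q Q' S S',
  f (Q :|: Q') (S :|: S') + f (Q :&: Q') (S :&: S') <= f Q S + f Q' S'.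
Hypothesis f_link : forall h, f [set h]%SET finset.set0 <= load.

Definition file_bits (i : 'I_N) : {set bits} := [set x | x.1 == i]%SET.

Hypothesis f_decode : forall (Q : {set 'I_H}) (S : {set bits}) k,
  relays net k \subset Q -> Z k \subset S ->
  f Q (S :|: file_bits (d k)) = f Q S.

Definition cachers (x : bits) : {set 'I_K} := [set k | x \in Z k]%SET.

Definition uncached (i : 'I_N) (U : {set 'I_K}) : {set bits} :=
  [set x | (x.1 == i) && (cachers x \subset ~: U)]%SET.

Definition known (U : {set 'I_K}) : {set bits} :=
  [set x | [exists k in U, (x \in Z k) || (x.1 == d k)]]%SET.

(* The entropy of the messages to the relays in Q, given the bits in S. *)
Let g Q S : R := f Q S - #|S|%:R.

Lemma cond_set0 S : g finset.set0 S = 0.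
Proof. by rewrite /g f_bits subrr. Qed.

Lemma cond_ge0 Q S : 0 <= g Q S.
Proof. by rewrite subr_ge0 -f_bits f_mono// finset.sub0set. Qed.

(** Conditioning on more bits cannot increase entropy: this is submodularity against an empty set of
    relays, where [f] just counts bits. *)
Lemma cond_anti Q (S S' : {set bits}) : S \subset S' -> g Q S' <= g Q S.
Proof.
move=> SS'; have := f_submod Q finset.set0 S S'.
rewrite finset.setU0 finset.setI0 (finset.setUidPr SS') (finset.setIidPl SS').
by rewrite !f_bits /g; lra.
Qed.

Lemma cond_submod S Q Q' : g (Q :|: Q') S + g (Q :&: Q') S <= g Q S + g Q' S.
Proof.
by have := f_submod Q Q' S S; rewrite finset.setUid finset.setIid /g; lra.
Qed.

Lemma cond_bigcup (I : finType) (P : pred I) (Qs : I -> {set 'I_H}) S :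
  g (\bigcup_(i | P i) Qs i)%SET S <= \sum_(i | P i) g (Qs i) S.
Proof.
elim/big_rec2: _ => [|i y Q _ IH]; first by rewrite cond_set0.
have := cond_submod S (Qs i) Q; have := cond_ge0 (Qs i :&: Q) S.
by move: IH; lra.
Qed.

Lemma cond_le_load Q : g Q finset.set0 <= #|Q|%:R * load.
Proof.
rewrite mulr_natl -sumr_const.
have -> : Q = (\bigcup_(h in Q) [set h])%SET.
  apply/setP => h; apply/idP/bigcupP => [hQ|[h' hQ /set1P->//]].
  by exists h; rewrite ?set11.
apply: le_trans (cond_bigcup _ _ _) _.
(* The earlier rewriting also changed the index set of the sum of loads; this restores it. *)
have -> : (\bigcup_(h in Q) [set h])%SET = Q.
  apply/setP => h; apply/bigcupP/idP => [[h' hQ /set1P->//]|hQ].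
  by exists h; rewrite ?set11.
by apply: ler_sum => h _; rewrite /g cards0 subr0 f_link.
Qed.

Lemma knownU1 k U : known (k |: U) = known U :|: Z k :|: file_bits (d k).
Proof.
apply/setP => x; rewrite !inE; apply/exists_inP/idP.
  move=> [k']; rewrite !inE => /orP[/eqP->|k'U xk'].
    by move=> /orP[->|->]; rewrite ?orbT.
  by apply/orP/or_introl/orP/or_introl/exists_inP; exists k'.
case/orP => [/orP[/exists_inP[k' k'U xk']|xk]|xk].
- by exists k' => //; rewrite !inE k'U orbT.
- by exists k; rewrite ?xk// !inE eqxx.
- by exists k; rewrite ?xk ?orbT// !inE eqxx.
Qed.

Lemma known_sub (U U' : {set 'I_K}) : U \subset U' -> known U \subset known U'.
Proof.
move=> /fintype.subsetP UU'; apply/fintype.subsetP => x; rewrite !inE.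
by move=> /exists_inP[k /UU' kU xk]; apply/exists_inP; exists k.
Qed.

(** Adding the cache of [k] to the condition does not raise [g]; the demanded file then leaves [f]
    unchanged while the condition gains bits. The bits of that file cached by nobody in [k |: U] are
    new: no user in [U] caches them, nor demands them, as [d] is injective. *)
Lemma cond_decode (Q : {set 'I_H}) (U : {set 'I_K}) k :
  relays net k \subset Q -> k \notin U ->
  #|uncached (d k) (k |: U)|%:R + g Q (known (k |: U)) <= g Q (known U).
Proof.
move=> kQ kU; have := cond_anti Q (finset.subsetUl (known U) (Z k)).
rewrite {1}/g -(f_decode kQ (finset.subsetUr (known U) (Z k))) -knownU1 /g.
suff : (#|uncached (d k) (k |: U)| + #|known U :|: Z k| <=
        #|known (k |: U)|)%N.
  by rewrite -(ler_nat R) natrD; lra.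
rewrite -cardsUI (_ : _ :&: _ = finset.set0) ?cards0 ?addn0.
  rewrite knownU1; apply/subset_leq_card/fintype.subsetP => x.
  rewrite !inE => /orP[/andP[->]|]; first by rewrite orbT.
  by rewrite orbC => ->.
apply/setP => x; rewrite !inE; apply/negP.
move=> /andP[/andP[/eqP xk /fintype.subsetP sub]].
have nU k' : k' \in k |: U -> x \notin Z k'.
  move=> k'U; apply/negP => xk'.
  by have := sub k'; rewrite !inE xk' => /(_ isT); rewrite -in_setU1 k'U.
case/orP => [/exists_inP[k' k'U]|]; last by rewrite (negPf (nU _ _)) ?setU11.
rewrite (negPf (nU _ _)) ?setU1r//= xk => /eqP/d_inj kk'.
by rewrite kk' k'U in kU.
Qed.

Lemma cond_chain (Q : {set 'I_H}) (U : {set 'I_K}) n (p : 'I_n -> 'I_K) :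
  injective p ->
  (forall j, relays net (p j) \subset Q) -> (forall j, p j \notin U) ->
  \sum_j #|uncached (d (p j)) (U :|: first_upto p j)|%:R
    + g Q (known (U :|: [set p j | j : 'I_n]%SET)) <= g Q (known U).
Proof.
move=> pI pQ pU.
have IH m : (m <= n)%N ->
  \sum_(j < n | (j < m)%N) #|uncached (d (p j)) (U :|: first_upto p j)|%:R
  + g Q (known (U :|: [set p j | j : 'I_n & (j < m)%N]%SET)) <= g Q (known U).
  elim: m => [_|m IH mn].
    rewrite big_pred0// add0r; apply: cond_anti; apply: known_sub.
    exact: finset.subsetUl.
  apply: le_trans (IH (ltnW mn)); pose j0 := Ordinal mn.
  rewrite (bigD1 j0) /=; last by rewrite leqnn.
  have -> : \sum_(j < n | (j < m.+1)%N && (j != j0))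
       #|uncached (d (p j)) (U :|: first_upto p j)|%:R
    = \sum_(j < n | (j < m)%N)
       #|uncached (d (p j)) (U :|: first_upto p j)|%:R :> R.
    by apply: eq_bigl => j; rewrite ltnS [RHS]ltn_neqAle andbC.
  (* [first_upto] includes its index, so the users counted at step [m] are the earlier ones and
     [p j0] itself. *)
  have UE : U :|: first_upto p j0 =
     p j0 |: (U :|: [set p j | j : 'I_n & (j < m)%N]%SET).
    rewrite finset.setUCA; congr (_ :|: _); apply/setP => k; rewrite in_setU1.
    apply/imsetP/orP => [[j]|[/eqP->|/imsetP[j]]].
    - rewrite inE leq_eqVlt => /orP[/eqP jm ->|jm ->]; [left|right].
        by apply/eqP; congr p; apply: val_inj.
      by apply/imsetP; exists j; rewrite ?inE.
    - by exists j0; rewrite ?inE.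
    - by rewrite inE => jm ->; exists j; rewrite ?inE ?(ltnW jm).
  have -> : [set p j | j : 'I_n & (j < m.+1)%N]%SET = first_upto p j0.
    by [].
  rewrite UE [leLHS]addrAC [leRHS]addrC lerD2r.
  apply: cond_decode => //; rewrite finset.in_setU negb_or pU/=.
  by apply/imsetP => -[j]; rewrite inE => jm /pI jj; rewrite -jj ltnn in jm.
have := IH n (leqnn n).
rewrite (eq_bigl predT) => [|j]; last by rewrite ltn_ord.
rewrite (_ : [set p j | j : 'I_n & (j < n)%N]%SET = [set p j | j : 'I_n]%SET)//.
by apply/setP => k; apply/imsetP/imsetP => -[j _ ->]; exists j; rewrite ?inE.
Qed.

Lemma ordering_mem (T : finType) (J : {set T}) (p : 'I_#|J| -> T) j :
  is_ordering p -> p j \in J.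
Proof. by case=> _ <-; apply: imset_f. Qed.

Lemma link_bound (Q : {set 'I_H}) a (Qs : 'I_a -> {set 'I_H}) (V : {set 'I_K})
    (p : forall i : 'I_a, 'I_#|users_within net (Qs i)| -> 'I_K)
    (q : 'I_#|(users_within net Q :\: V)%SET| -> 'I_K) :
  (\bigcup_(i < a) Qs i)%SET = Q ->
  (forall i j : 'I_a, i != j -> [disjoint Qs i & Qs j]) ->
  V = (\bigcup_(i < a) users_within net (Qs i))%SET ->
  (forall i : 'I_a, is_ordering (p i)) -> is_ordering q ->
  \sum_(i < a) \sum_(j < #|users_within net (Qs i)|)
     #|uncached (d (p i j)) (first_upto (p i) j)|%:R
  + \sum_(j < #|(users_within net Q :\: V)%SET|)
     #|uncached (d (q j)) (V :|: first_upto q j)|%:R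
  + g Q (known (users_within net Q)) <= #|Q|%:R * load.
Proof.
move=> QE Qdis VE pP qP.
have VQ : V \subset users_within net Q.
  rewrite VE; apply/bigcupsP => i _; apply/fintype.subsetP => k.
  rewrite !inE -QE => /fintype.subset_trans; apply.
  exact: (finset.bigcup_sup i).
have known0 : known finset.set0 = finset.set0.
  apply/setP => x; rewrite !inE; apply/exists_inP => -[k].
  by rewrite inE.
(* Each block is conditioned on what the users of all blocks know, not only its own, so that the
   remainders share one condition and subadditivity applies. *)
have first i : \sum_(j < #|users_within net (Qs i)|)
     #|uncached (d (p i j)) (first_upto (p i) j)|%:R + g (Qs i) (known V)
     <= #|Qs i|%:R * load.
  apply: le_trans (cond_le_load _); rewrite -known0.
  have [pI pJ] := pP i.
  have := @cond_chain (Qs i) finset.set0 _ (p i) pI.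
  rewrite pJ finset.set0U.
  under eq_bigr do rewrite finset.set0U.
  move=> chain; apply: le_trans (chain _ _).
  - rewrite lerD2l; apply/cond_anti/known_sub; rewrite VE.
    by apply: (finset.bigcup_sup i).
  - by move=> j; have := ordering_mem j (pP i); rewrite inE.
  - by move=> j; rewrite inE.
have second := @cond_chain Q V _ q.
have [qI qJ] := qP.
have {second} := second qI; rewrite qJ.
have -> : V :|: users_within net Q :\: V = users_within net Q.
  apply/setP => k; rewrite finset.in_setU finset.in_setD.
  by case: (boolP (k \in V)) => // /(fintype.subsetP VQ) ->.
move=> second; have {}second : \sum_(j < #|(users_within net Q :\: V)%SET|)
     #|uncached (d (q j)) (V :|: first_upto q j)|%:R
  + g Q (known (users_within net Q)) <= g Q (known V).
  apply: second => j; have := ordering_mem j qP; rewrite !inE => /andP[]//.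
(* Disjointness of the blocks makes their loads add up to exactly that of [Q]. *)
have cardQ : #|Q|%:R = \sum_(i < a) #|Qs i|%:R :> R.
  have cnt (A : {set 'I_H}) : (#|A| = \sum_h (h \in A))%N.
    by rewrite -sum1_card big_mkcond; apply: eq_bigr => h _; case: (h \in A).
  rewrite -natr_sum cnt; under [in RHS]eq_bigr do rewrite cnt.
  rewrite exchange_big /=; congr _%:R; apply: eq_bigr => h _.
  case: (boolP (h \in Q)); rewrite -{1}QE => /bigcupP hQ; last first.
    rewrite big1// => i _; case: (boolP (h \in Qs i)) => // hi.
    by case: hQ; exists i.
  have [i _ hi] := hQ; rewrite (bigD1 i)//= hi big1// => j ji.
  by rewrite (disjointFl (Qdis _ _ ji)).
have := @ler_sum R 'I_a (index_enum _) predT _ _ (fun i _ => first i).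
rewrite big_split /= -mulr_suml -cardQ => sumfirst.
have := cond_bigcup predT Qs (known V); rewrite QE => union.
by move: second sumfirst union; lra.
Qed.

Definition subfile_bits (i : 'I_N) (W : {set 'I_K}) : {set bits} :=
  [set x | (x.1 == i) && (cachers x == W)]%SET.

Lemma card_uncached i U :
  #|uncached i U| = (\sum_(W : {set 'I_K} | W \subset ~: U)
    #|subfile_bits i W|)%N.
Proof.
rewrite -sum1_card (partition_big cachers (fun W => W \subset ~: U)) /=.
  apply: eq_bigr => W WU; rewrite -sum1_card; apply: eq_bigl => x.
  rewrite !inE -andbA.
  by case: (cachers x =P W) => [->|]; rewrite ?WU ?andbF ?andbT.
by move=> x; rewrite inE => /andP[].
Qed.

(** * Summing the conditional entropies over all sets of [b] relays *)

Section CoefBound.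
Variables (b : nat) (p : 'I_K -> 'I_K).
Hypothesis b_gt0 : (0 < b)%N.
Hypothesis p_inj : injective p.

(** Accounting bit by bit: [weight x] is the total coefficient of [x] on the right-hand side of (b),
    [T] is its support, and [cover x] counts the sets of [b] relays for which [x] is part of the
    condition. *)
Let free i x := (x.1 == d (p i)) && (cachers x \subset ~: first_upto p i).
Let weight x : nat := \sum_(i | free i x) coef net (p i |: cachers x) b.
Let T : {set bits} := [set x | (0 < weight x)%N]%SET.
Let cover x : nat := #|[set Q : {set 'I_H} |
  (#|Q| == b) && (x \in known (users_within net Q))]%SET|.

(** At most one [i] makes [x] free, since distinct users demand distinct files. *)
Let weightE i x : free i x -> weight x = coef net (p i |: cachers x) b.
Proof.
move=> fi; rewrite /weight (bigD1 i)//= big1 ?addn0// => j /andP[fj ji].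
case/andP: fi => /eqP xi _; case/andP: fj => /eqP xj _.
by move: ji; rewrite xi in xj; rewrite (p_inj (d_inj xj)) eqxx.
Qed.

Let T_free x : x \in T -> exists i, free i x.
Proof.
rewrite inE /weight => T0; apply/existsP; apply: contraTT T0.
by rewrite negb_exists => /forallP nf; rewrite big_pred0// => i; apply: negPf.
Qed.

(** On [T] the truncated subtraction in [coef] is exact. If the users inside [Q] know [x], one of
    them caches or demands it and so lies in [p i |: cachers x]; hence [Q] is among the sets
    subtracted. *)
Let weight_cover x : x \in T -> (weight x + cover x <= 'C(H.-1, b.-1))%N.
Proof.
move=> xT; have [i fi] := T_free xT; move: xT; rewrite inE (weightE fi) /coef.
set n := #|_| => pos.
suff : (cover x <= n)%N by lia.
apply/subset_leq_card/fintype.subsetP => Q; rewrite !inE => /andP[->] /=.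
move=> /exists_inP[k kQ xk]; apply/negP => /fintype.subsetP /(_ _ kQ).
rewrite !inE; case/orP: xk => [->|]; first by rewrite orbT.
by case/andP: fi => /eqP -> _ /eqP/d_inj->; rewrite eqxx.
Qed.

(** The users decode in the order [p], starting from the bits outside [T]; [D m] collects the files
    of the first [m] users. A bit of [T] cached by [p m] lies in a file demanded by some [p i] and
    is cached by no user up to [p i]; hence [i < m], and the file is already in [D m]. *)
Let decode_all : f [set: 'I_H]%SET (~: T) = f [set: 'I_H]%SET [set: bits]%SET.
Proof.
pose D m : {set bits} :=
  [set x | [exists i : 'I_K, (i < m)%N && (x.1 == d (p i))]]%SET.
have IH m : (m <= K)%N ->
    f [set: 'I_H]%SET (~: T :|: D m) = f [set: 'I_H]%SET (~: T).
  elim: m => [_|m IH mK].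
    congr f; apply/setP => x; rewrite !inE orbC; case: existsP => // -[i].
    by rewrite ltn0.
  rewrite -(IH (ltnW mK)); pose j := Ordinal mK.
  rewrite -(@f_decode _ (~: T :|: D m) (p j)) ?finset.subsetT//.
    congr f; rewrite -finset.setUA; congr (_ :|: _).
    apply/setP => x; rewrite !inE; apply/existsP/orP.
      move=> [i /andP[]]; rewrite ltnS leq_eqVlt => /orP[/eqP im xi|im xi].
        right; rewrite (_ : j = i)//; apply: val_inj.
        by rewrite /= im.
      by left; apply/existsP; exists i; rewrite im.
    case=> [/existsP[i /andP[im xi]]|xi]; last by exists j; rewrite ltnS leqnn.
    by exists i; rewrite xi ltnS ltnW.
  apply/fintype.subsetP => x xj; rewrite finset.in_setU finset.in_setC.
  case: (boolP (x \in T)) => //= xT; rewrite inE.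
  have [i /andP[xi /fintype.subsetP sub]] := T_free xT.
  apply/existsP; exists i; rewrite xi andbT ltnNge; apply/negP => mi.
  have := sub (p j); rewrite !inE xj => /(_ isT)/negP; apply.
  by apply/imsetP; exists j; rewrite ?inE.
rewrite -(IH K (leqnn K)); congr f; apply/setP => x.
rewrite finset.in_setU finset.in_setC finset.in_setT.
case: (boolP (x \in T)) => //= xT; rewrite inE.
have [i /andP[xi _]] := T_free xT.
by apply/existsP; exists i; rewrite xi ltn_ord.
Qed.

Let weight_sum :
  \sum_(i < K) \sum_(W : {set 'I_K} | W \subset ~: first_upto p i)
     (coef net (p i |: W) b)%:R * #|subfile_bits (d (p i)) W|%:R
  = (\sum_(x in T) weight x)%:R :> R.
Proof.
have -> : (\sum_(x in T) weight x = \sum_x weight x)%N.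
  rewrite big_mkcond; apply: eq_bigr => x _; rewrite inE.
  by case: (weight x).
rewrite /weight [X in X%:R](exchange_big_dep predT)//= natr_sum.
apply: eq_bigr => i _.
rewrite (partition_big cachers (fun W => W \subset ~: first_upto p i)) /=.
  rewrite natr_sum; apply: eq_bigr => W WU; rewrite -natrM; congr _%:R.
  rewrite -sum1_card big_distrr /=; apply: eq_big => x.
    rewrite inE /free -andbA.
    case: (cachers x =P W) => [->|]; rewrite ?andbF ?andbT//.
    by rewrite WU andbT.
  by rewrite inE => /andP[_ /eqP->]; rewrite muln1.
by move=> x /andP[].
Qed.

Lemma coef_bound :
  \sum_(i < K) \sum_(W : {set 'I_K} | W \subset ~: first_upto p i)
     (coef net (p i |: W) b)%:R * #|subfile_bits (d (p i)) W|%:R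
  <= \sum_(Q : {set 'I_H} | #|Q| == b) g Q (known (users_within net Q)).
Proof.
rewrite weight_sum.
(* Enlarging the condition from [~: T] to its union with [S] does not lower [f] and adds
   [#|S :&: T|] bits; dropping [~: T] afterwards can only raise [g]. *)
have low Q : g Q (~: T) - #|known (users_within net Q) :&: T|%:R <=
    g Q (known (users_within net Q)).
  set S := known _.
  apply: le_trans (cond_anti Q (finset.subsetUl S (~: T))).
  have := f_mono (fintype.subxx Q) (finset.subsetUr S (~: T)).
  have : #|S :|: ~: T| = (#|S :&: T| + #|~: T|)%N.
    rewrite -(cardsID T (S :|: ~: T)); congr (_ + _)%N; apply: eq_card => x.
      rewrite !(finset.in_setI, finset.in_setU, finset.in_setC).
      by case: (x \in S); case: (x \in T).
    rewrite !(finset.in_setD, finset.in_setU, finset.in_setC).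
    by case: (x \in S); case: (x \in T).
  by rewrite /g => ->; rewrite natrD; lra.
apply: le_trans (ler_sum _ (fun Q _ => low Q)).
rewrite sumrB.
have := @han_ineq R H (fun Q => g Q (~: T))
  (cond_set0 _) (cond_submod _) b b_gt0.
have gT : #|T|%:R <= g [set: 'I_H]%SET (~: T).
  rewrite /g decode_all lerBrDr -natrD cardsC.
  have := f_mono (finset.sub0set [set: 'I_H]%SET)
    (fintype.subxx [set: bits]%SET).
  by rewrite f_bits cardsT.
have coverE : (\sum_(Q : {set 'I_H} | #|Q| == b)
    #|known (users_within net Q) :&: T| = \sum_(x in T) cover x)%N.
  rewrite (eq_bigr (fun Q => \sum_(x in known (users_within net Q) :&: T) 1)%N);
    last by move=> Q _; rewrite sum1_card.
  rewrite (exchange_big_dep (mem T))/=; last first.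
    by move=> Q x _; rewrite inE => /andP[].
  apply: eq_bigr => x xT; rewrite /cover -sum1_card; apply: eq_bigl => Q.
  by rewrite !inE; move: xT; rewrite inE => ->; rewrite andbT.
rewrite -natr_sum coverE.
(* Double counting over the bits of [T]: weights and covers together fit into the lower bound given
   by Han's inequality. *)
have total : (\sum_(x in T) weight x + \sum_(x in T) cover x <=
    'C(H.-1, b.-1) * #|T|)%N.
  rewrite -big_split mulnC -sum_nat_const; apply: leq_sum => x xT.
  exact: weight_cover.
move: total; rewrite -(ler_nat R) natrD natrM => total.
have : 'C(H.-1, b.-1)%:R * #|T|%:R <=
    'C(H.-1, b.-1)%:R * g [set: 'I_H]%SET (~: T) by rewrite ler_wpM2l.
by move: total; lra.
Qed.

End CoefBound.

End Converse.

(** * The entropies of a scheme *)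

Section SchemeEntropy.
Variables (R : realType) (H r : nat) (net : network H r) (N : nat) (M : R).
Variables (B : nat) (s : scheme net N M B).
Local Notation K := 'C(H, r).
Local Notation bits := ('I_N * 'I_B)%type.
Variable d : {ffun 'I_K -> 'I_N}.

Definition all_decoded : {set files N B} :=
  [set F | [forall k, decoded s d k F == F (d k)]]%SET.

Definition repair (F : files N B) : option (files N B) :=
  if F \in all_decoded then None else Some F.

(* Appending the repair symbol to every message makes decoding error-free, at
   a cost in entropy that vanishes with the error probability. *)
Definition view (Q : {set 'I_H}) (S : {set bits}) (F : files N B) :=
  ([ffun h => if h \in Q then Some (tval (server_msg s d h F), repair F)
              else None], read_bits S F).

Definition view_entropy (Q : {set 'I_H}) (S : {set bits}) : R :=
  entropy R (view Q S).

Let zero_files : files N B := [ffun=> [tuple of nseq B false]].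

Lemma viewP (Q : {set 'I_H}) (S : {set bits}) F F' : reflect
  ((forall h, h \in Q -> tval (server_msg s d h F) = tval (server_msg s d h F')
      /\ repair F = repair F') /\
   (forall x, x \in S -> tnth (F x.1) x.2 = tnth (F' x.1) x.2))
  (view Q S F == view Q S F').
Proof.
apply: (iffP eqP) => [[/ffunP eQ /ffunP eS]|[eQ eS]].
  split=> [h hQ|x xS]; first by have := eQ h; rewrite !ffunE hQ => -[-> ->].
  by have := eS x; rewrite !ffunE xS => -[].
congr pair; apply/ffunP => x; rewrite !ffunE; case: ifP => // xQ.
  by have [-> ->] := eQ x xQ.
by rewrite eS.
Qed.

Lemma view_entropy_mono (Q Q' : {set 'I_H}) (S S' : {set bits}) :
  Q \subset Q' -> S \subset S' -> view_entropy Q S <= view_entropy Q' S'.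
Proof.
move=> /fintype.subsetP QQ /fintype.subsetP SS.
apply: (le_entropy R zero_files) => F F' /eqP/viewP[eQ eS].
by apply/eqP/viewP; split=> [h /QQ/eQ|x /SS/eS].
Qed.

Lemma view_entropy_submod (Q Q' : {set 'I_H}) (S S' : {set bits}) :
  view_entropy (Q :|: Q') (S :|: S') + view_entropy (Q :&: Q') (S :&: S') <=
  view_entropy Q S + view_entropy Q' S'.
Proof.
apply: (entropy_submod R zero_files) => F F'.
- apply/viewP/andP => [[eQ eS]|[/viewP[eQ eS] /viewP[eQ' eS']]].
    by split; apply/viewP; split=> [h hQ|x xS]; (apply: eQ || apply: eS);
      rewrite finset.in_setU ?hQ ?xS ?orbT.
  by split=> [h|x]; rewrite finset.in_setU => /orP[]; auto.
- move=> /eqP/viewP[eQ eS]; apply/eqP/viewP.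
  by split=> [h|x]; rewrite finset.in_setI => /andP[? _]; auto.
- move=> /eqP/viewP[eQ eS]; apply/eqP/viewP.
  by split=> [h|x]; rewrite finset.in_setI => /andP[_ ?]; auto.
Qed.

Lemma ln_expn2 n : ln (2 ^ n)%:R / ln 2 = n%:R :> R.
Proof.
rewrite natrX lnXn ?ltr0n// -(mulr_natl (ln _)) mulfK// gt_eqF//.
exact: ln2_gt0.
Qed.

Lemma card_files : #|{: files N B}| = (2 ^ (N * B))%N.
Proof. by rewrite card_ffun card_tuple card_bool card_ord -expnM mulnC. Qed.

(** The repair symbol is attached to messages, so an empty [Q] shows only the bits in [S]. Counting
    values gives the upper bounds [#|S|] and [#|~: S|]; by submodularity the two entropies sum to at
    least [N * B], so both bounds are attained. *)
Lemma view_entropy_bits (S : {set bits}) : view_entropy finset.set0 S = #|S|%:R.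
Proof.
have ub (S' : {set bits}) : view_entropy finset.set0 S' <= #|S'|%:R.
  pose g (F : files N B) : {ffun {x | x \in S'} -> bool} :=
    [ffun u => tnth (F (val u).1) (val u).2].
  rewrite -ln_expn2; have -> : (2 ^ #|S'| = #|{ffun {x | x \in S'} -> bool}|)%N.
    by rewrite card_ffun card_bool card_sig.
  apply: le_trans (entropy_le_card R zero_files g).
  apply: (le_entropy R zero_files) => F F' /ffunP gF.
  apply/eqP/viewP; split=> [h|x xS]; first by rewrite inE.
  by have := gF (exist _ x xS); rewrite !ffunE.
have := view_entropy_submod finset.set0 finset.set0 S (~: S).
rewrite finset.setUid finset.setIid finset.setUCr finset.setICr.
have -> : view_entropy finset.set0 [set: bits]%SET = (N * B)%:R.
  rewrite /view_entropy entropy_inj ?card_files ?ln_expn2// => F F'.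
  move=> /eqP/viewP[_ eF]; apply/ffunP => i; apply: eq_from_tnth => j.
  by apply: (eF (i, j)); rewrite finset.in_setT.
have := ub S; have := ub (~: S); have := entropy_ge0 R zero_files.
have : (#|S| + #|~: S|)%:R = (N * B)%:R :> R.
  by rewrite cardsC card_prod !card_ord.
move=> c /(_ _ (view finset.set0 finset.set0)).
by rewrite -/(view_entropy _ _) natrD in c *; lra.
Qed.

(** Since [r] is positive, user [k] sees some message and with it the repair symbol. Either the
    symbol reveals the library, or both libraries decode correctly from equal inputs and so agree on
    the demanded file. *)
Lemma view_entropy_decode (Q : {set 'I_H}) (S : {set bits}) k : (0 < r)%N ->
  relays net k \subset Q -> stored s k \subset S ->
  view_entropy Q (S :|: file_bits B (d k)) = view_entropy Q S.
Proof.
move=> r0 /fintype.subsetP kQ /fintype.subsetP kS.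
apply: (entropy_eq R zero_files) => F F'.
apply/viewP/viewP => -[eQ eS]; split=> // x xS.
  by apply: eS; rewrite finset.in_setU xS.
move: xS; rewrite finset.in_setU => /orP[/eS//|]; rewrite inE => /eqP->.
have [h hk] : exists h, h \in relays net k.
  by apply/card_gt0P; rewrite card_relays.
have [_] := eQ h (kQ _ hk); rewrite /repair.
case: ifPn => FA; case: ifPn => FA' //; last by case=> ->.
move=> _.
move: FA FA'; rewrite !inE => /forallP/(_ k)/eqP <- /forallP/(_ k)/eqP <-.
congr tnth; rewrite /decoded.
have -> : read_bits (stored s k) F = read_bits (stored s k) F'.
  by apply/ffunP => z; rewrite !ffunE; case: ifP => // /kS/eS->.
suff -> : received s d k F = received s d k F' by [].
apply/funext => h'; rewrite /received; case: ifP => // /kQ/eQ[hh _].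
by rewrite (_ : server_msg s d h' F = server_msg s d h' F')//; apply: val_inj.
Qed.

(** In bits, not normalized by [B]: the link length plus the bound of [entropy_repair], in which the
    entropy of the library is [N * B]. *)
Definition repaired_load : R :=
  B%:R * max_link_load s + error_prob s * (N%:R * B%:R + (ln 2)^-1).

Lemma relays_onto (A : {set 'I_H}) : #|A| = r -> exists k, relays net k = A.
Proof.
move=> Ar; pose D := [set A : {set 'I_H} | #|A| == r]%SET.
have : [set relays net k | k : 'I_K]%SET = D.
  apply/eqP; rewrite eqEcard card_imset; last exact: relays_inj.
  rewrite card_draws !card_ord leqnn andbT.
  by apply/fintype.subsetP => _ /imsetP[k _ ->]; rewrite inE card_relays.
move=> /setP/(_ A); rewrite [RHS]inE Ar eqxx => /imsetP[k _ ->].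
by exists k.
Qed.

(** Needed because [max_link_load] ranges over users: it would not bound the server link of a relay
    without users. *)
Lemma relay_has_user (h : 'I_H) : (0 < r)%N -> (r <= H)%N ->
  exists k, k \in users net h.
Proof.
move=> r0 rH.
have : (0 < #|[set Q : {set 'I_H} | (#|Q| == r) && (h \in Q)]%SET|)%N.
  rewrite card_draws_containing// card_ord bin_gt0.
  by move: r0 rH; case: (r) => //; case: (H).
case/card_gt0P => A; rewrite inE => /andP[/eqP/relays_onto[k kA] hA].
by exists k; rewrite inE kA.
Qed.

Lemma view_entropy_link (h : 'I_H) : (0 < r)%N -> (r <= H)%N -> (0 < B)%N ->
  view_entropy [set h]%SET finset.set0 <= repaired_load.
Proof.
move=> r0 rH B0.
have B0' : 0 < B%:R :> R by rewrite ltr0n.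
have msg : view_entropy [set h]%SET finset.set0 <=
   entropy R (server_msg s d h) + entropy R repair.
  apply: le_trans (entropy_pair R zero_files _ _).
  apply: (le_entropy R zero_files) => F F' [msgE repE].
  apply/eqP/viewP; split=> [h' /set1P->|x]; last by rewrite inE.
  by rewrite msgE repE.
apply: le_trans msg _; apply: lerD.
  apply: (@le_trans _ _ (server_len s d h)%:R).
    apply: le_trans (entropy_le_card R zero_files _) _.
    by rewrite card_tuple card_bool ln_expn2.
  have [k kh] := relay_has_user h r0 rH.
  rewrite mulrC -ler_pdivrMr//.
  apply: le_trans (le_bigmax _ _ d).
  apply: le_trans (le_bigmax _ _ h).
  apply: le_trans (le_bigmax_cond _ _ kh).
  by rewrite le_max lexx.
apply: le_trans (entropy_repair R zero_files all_decoded) _.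
rewrite -mulrA; apply: ler_pM.
- by rewrite divr_ge0.
- apply: divr_ge0; last exact/ltW/ln2_gt0.
  by rewrite addr_ge0// ln_ge0// ler1n card_files expn_gt0.
- apply: le_trans (le_bigmax _ _ d).
  rewrite (_ : ~: all_decoded =
    [set F : files N B | [exists k, decoded s d k F != F (d k)]]%SET)//.
  by apply/setP => F; rewrite !inE negb_forall.
- by rewrite mulrDl div1r card_files ln_expn2 natrM.
Qed.

End SchemeEntropy.

(** * Averaging over demands *)

Section Averaging.
Variables (R : realType) (H r : nat) (net : network H r) (N : nat) (M : R).
Variables (B : nat) (s : scheme net N M B).
Local Notation K := 'C(H, r).
Hypotheses (r_gt0 : (0 < r)%N) (r_le_H : (r <= H)%N) (K_le_N : (K <= N)%N).
Hypothesis B_gt0 : (0 < B)%N.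

Lemma files_gt0 : (0 < N)%N.
Proof. by rewrite (leq_trans _ K_le_N)// bin_gt0. Qed.

(* Averaging over the cyclic shifts of one injective demand vector already
   makes every user demand every file equally often. *)
Definition shift_demand (j : 'I_N) : {ffun 'I_K -> 'I_N} :=
  [ffun k : 'I_K => Ordinal (ltn_pmod (k + j) files_gt0)].

Lemma shift_demand_inj j : injective (shift_demand j).
Proof.
move=> k k'; rewrite !ffunE => /(congr1 val) /= /eqP.
rewrite eqn_modDr !modn_small ?(leq_trans (ltn_ord _))// => /eqP.
exact: val_inj.
Qed.

Lemma shift_demand_inj_shift (k : 'I_K) : injective (fun j => shift_demand j k).
Proof.
move=> j j'; rewrite !ffunE => /(congr1 val) /= /eqP.
by rewrite eqn_modDl !modn_small// => /eqP /val_inj.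
Qed.

Lemma card_subfile i W : #|subfile s i W| = #|subfile_bits (stored s) i W|.
Proof.
rewrite -(card_imset (subfile s i W) (f := pair i)); last by move=> ? ? [].
apply: eq_card => -[i' t]; rewrite !inE /=.
apply/imsetP/andP => [[t']|[/eqP-> W']].
  by rewrite inE => W' [-> ->].
by exists t; rewrite ?inE.
Qed.

Lemma sum_shift_subfile k W :
  \sum_j #|subfile_bits (stored s) (shift_demand j k) W|%:R
  = (N * B)%:R * subfile_size s W :> R.
Proof.
rewrite /subfile_size mulrA mulfV ?mul1r; last first.
  by rewrite pnatr_eq0 -lt0n muln_gt0 files_gt0.
rewrite [RHS](reindex_inj (shift_demand_inj_shift (k := k))) /=.
by apply: eq_bigr => j _; rewrite card_subfile.
Qed.

Lemma sum_shift_uncached k U :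
  \sum_j #|uncached (stored s) (shift_demand j k) U|%:R
  = (N * B)%:R * \sum_(W : {set 'I_K} | W \subset ~: U) subfile_size s W :> R.
Proof.
under eq_bigr do rewrite card_uncached natr_sum.
rewrite exchange_big mulr_sumr /=; apply: eq_bigr => W _.
exact: sum_shift_subfile.
Qed.

Let cond j Q (S : {set 'I_N * 'I_B}) : R :=
  view_entropy s (shift_demand j) Q S - #|S|%:R.

Let kn j Q := known (stored s) (shift_demand j) (users_within net Q).

(** The finite-size version of y_Q, averaged over the demand shifts and measured in units of [B]
    bits. *)
Definition residual (Q : {set 'I_H}) : R :=
  (N * B)%:R^-1 * \sum_j (view_entropy s (shift_demand j) Q
      (known (stored s) (shift_demand j) (users_within net Q))
    - #|known (stored s) (shift_demand j) (users_within net Q)|%:R).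

Lemma residual_ge0 Q : 0 <= residual Q.
Proof.
rewrite mulr_ge0 ?invr_ge0//; apply: sumr_ge0 => j _.
exact: (cond_ge0 (view_entropy_bits s _)
  (@view_entropy_mono _ _ _ _ _ _ _ s _)).
Qed.

Let NB_gt0 : 0 < (N * B)%:R :> R.
Proof. by rewrite ltr0n muln_gt0 files_gt0. Qed.

(** There are [N] shifts, so dividing the sum of the bounds for single demands by [N * B] leaves the
    load normalized by [B]. *)
Let avg_load (Q : {set 'I_H}) (X : R) (c : 'I_N -> R) :
  (forall j, c j <= #|Q|%:R * repaired_load s) ->
  \sum_j c j = (N * B)%:R * X ->
  X <= #|Q|%:R * (repaired_load s / B%:R).
Proof.
move=> cj cX; rewrite -(ler_pM2l NB_gt0) -cX.
apply: le_trans (ler_sum _ (fun j _ => cj j)) _.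
rewrite sumr_const card_ord -mulr_natl natrM.
rewrite le_eqVlt; apply/orP/or_introl/eqP; field.
by rewrite pnatr_eq0 -lt0n.
Qed.

(** This keeps the residuals eventually bounded, so that their limit superior is a real number. *)
Lemma residual_le Q : residual Q <= #|Q|%:R * (repaired_load s / B%:R).
Proof.
apply: (avg_load (c := fun j => cond j Q (kn j Q))) => [j|]; last first.
  by rewrite /residual mulrA mulfV ?mul1r// gt_eqF.
have mono := @view_entropy_mono _ _ _ _ _ _ _ s (shift_demand j).
have bitsE := view_entropy_bits s (shift_demand j).
have submod := @view_entropy_submod _ _ _ _ _ _ _ s (shift_demand j).
apply: le_trans (cond_anti bitsE submod Q (finset.sub0set _)) _.
apply: cond_le_load => // h; exact: view_entropy_link.
Qed.

Lemma avg_link_bound (Q : {set 'I_H}) a (Qs : 'I_a -> {set 'I_H})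
    (V : {set 'I_K})
    (p : forall i : 'I_a, 'I_#|users_within net (Qs i)| -> 'I_K)
    (q : 'I_#|(users_within net Q :\: V)%SET| -> 'I_K) :
  (\bigcup_(i < a) Qs i)%SET = Q ->
  (forall i j : 'I_a, i != j -> [disjoint Qs i & Qs j]) ->
  V = (\bigcup_(i < a) users_within net (Qs i))%SET ->
  (forall i : 'I_a, is_ordering (p i)) -> is_ordering q ->
  \sum_(i < a) \sum_(j < #|users_within net (Qs i)|)
     \sum_(W : {set 'I_K} | W \subset (~: first_upto (p i) j)%SET)
       subfile_size s W
  + \sum_(j < #|(users_within net Q :\: V)%SET|)
     \sum_(W : {set 'I_K} | W \subset ((~: V) :\: first_upto q j)%SET)
       subfile_size s W
  + residual Q <= #|Q|%:R * (repaired_load s / B%:R).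
Proof.
move=> QE Qdis VE pP qP.
pose c j := \sum_(i < a) \sum_(l < #|users_within net (Qs i)|)
     #|uncached (stored s) (shift_demand j (p i l)) (first_upto (p i) l)|%:R
  + \sum_(l < #|(users_within net Q :\: V)%SET|)
     #|uncached (stored s) (shift_demand j (q l)) (V :|: first_upto q l)|%:R
  + cond j Q (kn j Q).
apply: (avg_load (c := c)) => [j|].
  apply: (link_bound (shift_demand_inj (j := j)) (view_entropy_bits s _)
    (@view_entropy_mono _ _ _ _ _ _ _ s _)
    (@view_entropy_submod _ _ _ _ _ _ _ s _)) => //.
  - by move=> h; exact: view_entropy_link.
  - by move=> Q' S k; exact: view_entropy_decode.
rewrite /c !big_split /= !mulrDr; congr (_ + _ + _).
- rewrite exchange_big mulr_sumr; apply: eq_bigr => i _ /=.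
  rewrite exchange_big mulr_sumr; apply: eq_bigr => l _ /=.
  exact: sum_shift_uncached.
- rewrite exchange_big mulr_sumr; apply: eq_bigr => l _ /=.
  rewrite sum_shift_uncached; congr (_ * _); apply: eq_bigl => W.
  by move: (first_upto q l) => F; rewrite finset.setCU finset.setDE.
- by rewrite /residual mulrA mulfV ?gt_eqF// mul1r big_split.
Qed.

Lemma avg_coef_bound b (p : 'I_K -> 'I_K) : (0 < b)%N -> injective p ->
  \sum_(i < K) \sum_(W : {set 'I_K} | W \subset (~: first_upto p i)%SET)
     (coef net (p i |: W)%SET b)%:R * subfile_size s W
  <= \sum_(Q : {set 'I_H} | #|Q| == b) residual Q.
Proof.
move=> b0 pI; rewrite -(ler_pM2l NB_gt0).
have -> : (N * B)%:R * (\sum_(Q : {set 'I_H} | #|Q| == b) residual Q) =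
    \sum_j \sum_(Q : {set 'I_H} | #|Q| == b) cond j Q (kn j Q).
  rewrite exchange_big mulr_sumr; apply: eq_bigr => Q _ /=.
  by rewrite /residual mulrA mulfV ?mul1r// gt_eqF.
have -> : (N * B)%:R * (\sum_(i < K)
    \sum_(W : {set 'I_K} | W \subset (~: first_upto p i)%SET)
     (coef net (p i |: W)%SET b)%:R * subfile_size s W) =
   \sum_j \sum_(i < K) \sum_(W : {set 'I_K} | W \subset (~: first_upto p i)%SET)
     (coef net (p i |: W)%SET b)%:R *
     #|subfile_bits (stored s) (shift_demand j (p i)) W|%:R.
  rewrite exchange_big mulr_sumr; apply: eq_bigr => i _ /=.
  rewrite exchange_big mulr_sumr; apply: eq_bigr => W _ /=.
  by rewrite -mulr_sumr sum_shift_subfile mulrCA.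
apply: ler_sum => j _.
apply: (coef_bound (shift_demand_inj (j := j)) (view_entropy_bits s _)
    (@view_entropy_mono _ _ _ _ _ _ _ s _)
    (@view_entropy_submod _ _ _ _ _ _ _ s _)) => //.
by move=> Q' S k; exact: view_entropy_decode.
Qed.

Lemma sum_subfile_size : \sum_(W : {set 'I_K}) subfile_size s W = 1.
Proof.
rewrite -mulr_sumr exchange_big /= (eq_bigr (fun=> B%:R)) => [|i _].
  by rewrite sumr_const card_ord -(mulr_natl B%:R) -natrM mulVf// gt_eqF.
rewrite -natr_sum; congr _%:R.
rewrite -[RHS]card_ord -sum1_card.
rewrite (partition_big (fun t => [set k | (i, t) \in stored s k]%SET) predT)//=.
by apply: eq_bigr => W _; rewrite -sum1_card; apply: eq_bigl => t; rewrite !inE.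
Qed.

Lemma sum_subfile_size_cached k :
  \sum_(W : {set 'I_K} | k \in W) subfile_size s W <= M / N%:R.
Proof.
rewrite -mulr_sumr exchange_big /=.
have -> : \sum_(i < N) \sum_(W : {set 'I_K} | k \in W) #|subfile s i W|%:R
    = #|stored s k|%:R :> R.
  under eq_bigr do rewrite -natr_sum; rewrite -natr_sum; congr _%:R.
  rewrite -sum1_card (partition_big fst predT)//=; apply: eq_bigr => i _.
  rewrite (partition_big (cachers (stored s)) (fun W => k \in W)) /=;
    last first.
    by move=> x /andP[xk _]; rewrite inE.
  apply: eq_bigr => W kW; rewrite card_subfile -sum1_card; apply: eq_bigl => x.
  rewrite inE -[RHS]andbA.
  case: (cachers _ x =P W) => [xW|]; rewrite ?andbF// !andbT.
  by move: kW; rewrite -xW inE => ->.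
rewrite ler_pdivrMl//; apply: le_trans (card_stored s k) _.
rewrite natrM le_eqVlt; apply/orP/or_introl/eqP; field.
by rewrite pnatr_eq0 -lt0n files_gt0.
Qed.

End Averaging.

(** * The limit of large files *)

Section Limits.
Local Open Scope classical_set_scope.
Local Open Scope ring_scope.
Variable R : realType.

Lemma near_subseq (phi : nat -> nat) (P : nat -> Prop) :
  {homo phi : m n / (m < n)%N} -> (\forall n \near \oo, P n) ->
  \forall n \near \oo, P (phi n).
Proof.
move=> phi_lt [m _ mP].
have phi_ge n : (n <= phi n)%N.
  by elim: n => // n IH; exact: leq_ltn_trans IH (phi_lt _ _ (ltnSn n)).
by exists m => // n /= mn; apply: mP => /=; exact: leq_trans mn (phi_ge n).
Qed.

Lemma near_le_limn_esup (u : nat -> R) (l e : R) :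
  (limn_esup (fun n => (u n)%:E) <= l%:E)%E -> 0 < e ->
  \forall n \near \oo, u n <= l + e.
Proof.
move=> ul e0.
have : (limn_esup (fun n => (u n)%:E) < (l + e)%:E)%E.
  by apply: le_lt_trans ul _; rewrite lte_fin ltrDl.
rewrite /limn_esup limf_esupE => /ereal_inf_lt[_ [V V_oo <-] Vlt].
apply: filterS V_oo => n Vn; rewrite -lee_fin.
apply: le_trans (ltW Vlt); apply: ereal_sup_ubound.
by exists n.
Qed.

(** The limit superior, as the infimum of the eventual upper bounds. The bound up to [e] serves (b),
    the minimality serves (a). *)
Lemma bounded_limsup (u : nat -> R) (c : R) :
  (forall n, 0 <= u n) -> (\forall n \near \oo, u n <= c) ->
  exists y : R, [/\ 0 <= y,
    forall e, 0 < e -> \forall n \near \oo, u n <= y + e &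
    forall z, (\forall n \near \oo, u n <= z) -> y <= z].
Proof.
move=> u0 uc.
pose E : classical_sets.set R := fun z => \forall n \near \oo, u n <= z.
have lbE : lbound E 0.
  by move=> z Ez; have [n] := filter_ex Ez; exact: le_trans.
have infE : has_inf E by split; [exists c | exists 0].
exists (inf E); split=> [|e e0|z Ez].
- by apply: lb_le_inf => //; exists c.
- have [z Ez zlt] := inf_adherent e0 infE.
  by apply: filterS Ez => n /le_trans; apply; exact: ltW.
- by apply: ge_inf => //; exists 0.
Qed.

Lemma cvg_sumr (I : finType) (P : pred I) (u : nat -> I -> R) (l : I -> R) :
  (forall i, (u n i @[n --> \oo] --> l i)%classic) ->
  ((\sum_(i | P i) u n i) @[n --> \oo] --> \sum_(i | P i) l i)%classic.
Proof.
move=> ul; apply: (cvg_big (@add_continuous R)) => i _.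
exact: ul.
Qed.

Lemma near_repaired_load (H r N : nat) (M : R) (net : network H r)
    (B : nat -> nat) (s : forall n, scheme net N M (B n)) (L : R) :
  achieves s L -> forall e : R, 0 < e ->
  \forall n \near \oo, (0 < B n)%N /\ repaired_load (s n) / (B n)%:R <= L + e.
Proof.
move=> [B_oo err0 loadL] e e0.
(* Once [B n] is at least 1, [C] bounds the factor of the error probability left after division by
   [B n]. *)
pose C : R := N%:R + (ln 2)^-1.
have C0 : 0 < C by rewrite ltr_wpDl// invr_gt0 ln2_gt0.
have e2 : 0 < e / 2 by rewrite divr_gt0.
have eC : 0 < e / 2 / C by rewrite divr_gt0.
have B0 : \forall n \near \oo, (0 < B n)%N by move/cvgnyPgt : B_oo; exact.
have err : \forall n \near \oo, error_prob (s n) <= e / 2 / C.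
  exact: cvgr_le err0 _ eC.
have ld := near_le_limn_esup loadL e2.
apply: (filterS3 _ _ B0 err ld) => n Bn errn ldn; split => //.
have Bn' : 1 <= (B n)%:R :> R by rewrite ler1n.
have Bn0 : 0 < (B n)%:R :> R by rewrite ltr0n.
have -> : repaired_load (s n) / (B n)%:R =
    max_link_load (s n) + error_prob (s n) * (N%:R + (ln 2)^-1 / (B n)%:R).
  by rewrite /repaired_load; field; rewrite !gt_eqF ?ln2_gt0.
have err_ge0 : 0 <= error_prob (s n) by exact: bigmax_ge_id.
have : error_prob (s n) * (N%:R + (ln 2)^-1 / (B n)%:R) <= e / 2.
  apply: (@le_trans _ _ (error_prob (s n) * C)); last by rewrite -ler_pdivlMr.
  rewrite ler_wpM2l// lerD2l ler_pdivrMr// ler_peMr// ltW// invr_gt0.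
  exact: ln2_gt0.
by lra.
Qed.

End Limits.

(** * Passage to the limit along the subsequence *)

Theorem theorem5 (R : realType) (H r N : nat) (M : R) (net : network H r)
    (r_gt0 : (1 <= r)%N) (r_le_H : (r <= H)%N) (K_le_N : ('C(H, r) <= N)%N)
    (M_ge0 : 0 <= M) (M_le_N : M <= N%:R)
    (Ru : R) (Ru_opt : is_optimal_load net N M Ru)
    (B : nat -> nat) (s : forall n, scheme net N M (B n))
    (s_opt : achieves s Ru)
    (x : {set 'I_'C(H, r)} -> R)
    (x_lim : subseq_limit (fun n => subfile_size (s n)) x) :
  [/\ \sum_(W : {set 'I_'C(H, r)}) x W = 1,
      forall i : 'I_'C(H, r),
        \sum_(W : {set 'I_'C(H, r)} | i \in W) x W <= M / N%:R
    & exists y : {set 'I_H} -> R,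
      [/\ forall Q : {set 'I_H}, (r <= #|Q|)%N -> 0 <= y Q,
          forall (b : nat) (Q : {set 'I_H}) (a : nat) (Qs : 'I_a -> {set 'I_H})
            (V : {set 'I_'C(H, r)})
            (p : forall i : 'I_a, 'I_#|users_within net (Qs i)| -> 'I_'C(H, r))
            (q : 'I_#|(users_within net Q :\: V)%SET| -> 'I_'C(H, r)),
            (r <= b <= H)%N -> #|Q| = b -> (1 <= a <= b %/ r)%N ->
            (\bigcup_(i < a) Qs i)%SET = Q ->
            (forall i j : 'I_a, i != j -> [disjoint Qs i & Qs j]) ->
            (forall i : 'I_a, (r <= #|Qs i|)%N) ->
            V = (\bigcup_(i < a) users_within net (Qs i))%SET ->
            (forall i : 'I_a, is_ordering (p i)) ->
            is_ordering q ->
            #|Q|%:R * Ru >=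
              \sum_(i < a) \sum_(j < #|users_within net (Qs i)|)
                \sum_(W : {set 'I_'C(H, r)} |
                      W \subset (~: first_upto (p i) j)%SET) x W
              + \sum_(j < #|(users_within net Q :\: V)%SET|)
                  \sum_(W : {set 'I_'C(H, r)} |
                        W \subset ((~: V) :\: first_upto q j)%SET) x W
              + y Q
        & forall (b : nat) (p : {perm 'I_'C(H, r)}),
            (r <= b <= H)%N ->
            \sum_(Q : {set 'I_H} | #|Q| == b) y Q >=
              \sum_(i < 'C(H, r))
                \sum_(W : {set 'I_'C(H, r)} |
                      W \subset (~: first_upto p i)%SET)
                  (coef net (p i |: W)%SET b)%:R * x W]].
Proof.
have [phi [phi_lt x_cvg]] := x_lim.
have good (e : R) (e0 : 0 < e) :=
  near_subseq phi_lt (near_repaired_load s_opt e0).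
have Bgt0 : \forall n \near \oo%classic, (0 < B (phi n))%N.
  by apply: filterS (good 1 ltr01) => n [].
split.
- have := cvg_sumr (P := predT) x_cvg.
  (* The sums are equal to 1 as soon as the file size is positive, so the sequence is eventually
     constant. *)
  move=> /cvg_lim <- //; apply: lim_near_cst => //.
  by apply: filterS Bgt0 => n Bn; rewrite /= (sum_subfile_size (s (phi n))).
- move=> i.
  have cvgS :=
    cvg_sumr (P := fun W : {set 'I_'C(H, r)} => i \in W) x_cvg.
  apply: cvgr_to_le cvgS _.
  apply: filterS Bgt0 => n Bn.
  exact: sum_subfile_size_cached.
pose u Q n := residual (s (phi n)) r_le_H K_le_N Q.
have u_ge0 Q n : 0 <= u Q n by exact: residual_ge0.
have u_le Q : \forall n \near \oo%classic, u Q n <= #|Q|%:R * (Ru + 1).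
  apply: filterS (good 1 ltr01) => n [Bn ldn].
  by apply: le_trans (residual_le _ _ _ _ _ _) _ => //; rewrite ler_wpM2l.
have [y yP] := choice (fun Q => bounded_limsup (u_ge0 Q) (u_le Q)).
exists y; split.
- by move=> Q _; have [] := yP Q.
- move=> b Q a Qs V p q _ _ _ QE Qdis _ VE pP qP.
  set S1 := \sum_(i < a) _; set S2 := \sum_(j < _) _.
  pose S n := \sum_(i < a) \sum_(j < #|users_within net (Qs i)|)
     \sum_(W : {set 'I_'C(H, r)} | W \subset (~: first_upto (p i) j)%SET)
       subfile_size (s (phi n)) W
  + \sum_(j < #|(users_within net Q :\: V)%SET|)
     \sum_(W : {set 'I_'C(H, r)} | W \subset ((~: V) :\: first_upto q j)%SET)
       subfile_size (s (phi n)) W.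
  have S_cvg : (S n @[n --> \oo] --> S1 + S2)%classic.
    apply: cvgD; apply: cvg_sumr => i; last exact: cvg_sumr.
    by apply: cvg_sumr => j; exact: cvg_sumr.
  apply/ler_addgt0Pr => e e0.
  (* The slack [e] is split into [#|Q|] parts for the load and one part for the sums of subfile
     sizes. *)
  pose e' : R := e / (#|Q|%:R + 1).
  have Q1 : 0 < #|Q|%:R + 1 :> R by rewrite ltr_wpDl.
  have e'0 : 0 < e' by rewrite divr_gt0.
  have eE : e = (#|Q|%:R + 1) * e' by rewrite /e'; field; rewrite gt_eqF.
  have [_ _ y_le] := yP Q.
  (* [y Q] is below every eventual upper bound of the residuals, and [avg_link_bound] supplies this
     one. *)
  suff : y Q <= #|Q|%:R * (Ru + e') - (S1 + S2 - e') by rewrite eE; lra.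
  have Slt : S1 + S2 - e' < S1 + S2 by rewrite ltrBlDr ltrDl.
  have S_ge : \forall n \near \oo%classic, S1 + S2 - e' <= S n.
    exact: cvgr_ge S_cvg _ Slt.
  apply: y_le; apply: (filterS2 _ _ (good e' e'0) S_ge).
  move=> n [Bn ldn] Sn.
    have := avg_link_bound (s (phi n)) r_gt0 r_le_H K_le_N Bn QE Qdis VE pP qP.
    rewrite -/(S n) -/(u Q n) => bnd.
    have : #|Q|%:R * (repaired_load (s (phi n)) / (B (phi n))%:R) <=
      #|Q|%:R * (Ru + e') by rewrite ler_wpM2l.
    by lra.
- move=> b p /andP[rb _].
  apply/ler_addgt0Pr => e e0.
  (* The number of sets of [b] relays, each of which receives the slack [e']; dividing by [m + 1]
     avoids proving [m] nonzero. *)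
  pose m : R := \sum_(Q : {set 'I_H} | #|Q| == b) 1.
  have m0 : 0 <= m by exact: sumr_ge0.
  pose e' : R := e / (m + 1).
  have m1 : 0 < m + 1 by rewrite ltr_wpDl.
  have e'0 : 0 < e' by rewrite divr_gt0.
  have : m * e' <= e.
    by rewrite /e' mulrCA ler_piMr ?(ltW e0)// ler_pdivrMr// mul1r lerDl.
  move=> me.
  apply: (@le_trans _ _ (\sum_(Q : {set 'I_H} | #|Q| == b) (y Q + e')));
    last first.
    rewrite big_split /= lerD2l; apply: le_trans me.
    by rewrite /m mulr_suml; apply: ler_sum => Q _; rewrite mul1r.
  (* There are finitely many [Q], so one threshold serves all of them. *)
  have y_ge : \forall n \near \oo%classic, forall Q, u Q n <= y Q + e'.
    by apply: filter_forall => Q; have [_ + _] := yP Q; exact.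
  have cvgS : (\sum_(i < 'C(H, r))
      \sum_(W : {set 'I_'C(H, r)} | W \subset (~: first_upto p i)%SET)
        (coef net (p i |: W)%SET b)%:R * subfile_size (s (phi n)) W
        @[n --> \oo] -->
      \sum_(i < 'C(H, r))
      \sum_(W : {set 'I_'C(H, r)} | W \subset (~: first_upto p i)%SET)
        (coef net (p i |: W)%SET b)%:R * x W)%classic.
    by apply: cvg_sumr => i; apply: cvg_sumr => W; exact: cvgMl_tmp.
  apply: cvgr_to_le cvgS _.
  apply: (filterS2 _ _ Bgt0 y_ge) => n Bn yn.
  have b0 : (0 < b)%N := leq_trans r_gt0 rb.
  have := avg_coef_bound (s (phi n)) r_gt0 r_le_H K_le_N Bn b0 (@perm_inj _ p).
  move=> /le_trans; apply.
  by apply: ler_sum => Q _; exact: yn.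
Qed.
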